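(* For every $k\in\{0,1,\dots,m-1\}$, denote the eigenvalues of $\mathcal A_{3,j}$ ($j\in\{k,k+1\}$), which comprise $m$ negative and $m+j$ positive eigenvalues, by $$\lambda_{-m}(\mathcal A_{3,j})\le\dots\le\lambda_{-1}(\mathcal A_{3,j})<0<\lambda_1(\mathcal A_{3,j})\le\dots\le\lambda_{m+j}(\mathcal A_{3,j}).$$ Then, when a new observation is introduced, the smallest and largest negative eigenvalues and the largest positive eigenvalue move away from zero or are unchanged, while the smallest positive eigenvalue approaches zero or is unchanged; that is, $$\lambda_{-m}(\mathcal A_{3,k+1})\le\lambda_{-m}(\mathcal A_{3,k}),\qquad \lambda_{-1}(\mathcal A_{3,k+1})\le\lambda_{-1}(\mathcal A_{3,k}),$$ $$\lambda_{m+k}(\mathcal A_{3,k})\le\lambda_{m+k+1}(\mathcal A_{3,k+1}),\qquad \lambda_{1}(\mathcal A_{3,k+1})\le\lambda_{1}(\mathcal A_{3,k}).$$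
   Context: Let $N,n\ge 1$ be integers and $m=(N+1)n$. Let $B,Q_1,\dots,Q_N\in\mathbb R^{n\times n}$ be symmetric positive definite and $M_0,\dots,M_{N-1}\in\mathbb R^{n\times n}$ arbitrary. Let $\mathbf D=\mathrm{diag}(B,Q_1,\dots,Q_N)\in\mathbb R^{m\times m}$ (block diagonal), and let $\mathbf L\in\mathbb R^{m\times m}$ be the block lower bidiagonal matrix with $n\times n$ identity blocks on the diagonal and blocks $-M_0,\dots,-M_{N-1}$ on the first block subdiagonal (all other blocks zero). A system with $k$ observations is described by a symmetric positive definite matrix $\mathbf R_k\in\mathbb R^{k\times k}$ and a matrix $\mathbf H_k\in\mathbb R^{k\times m}$ (both empty for $k=0$). Adding one observation means passing to $$\mathbf R_{k+1}=\begin{pmatrix}\mathbf R_k& r\\ r^T&\alpha\end{pmatrix},\qquad \mathbf H_{k+1}=\begin{pmatrix}\mathbf H_k\\ h_{k+1}^T\end{pmatrix},$$ with $r\in\mathbb R^k$, $\alpha>0$, $h_{k+1}\in\mathbb R^m$ and $\mathbf R_{k+1}$ symmetric positive definite; $\mathbf D$ and $\mathbf L$ are unchanged. Define $$\mathcal A_{3,k}=\begin{pmatrix}\mathbf D&\mathbf 0&\mathbf L\\ \mathbf 0&\mathbf R_k&\mathbf H_k\\ \mathbf L^T&\mathbf H_k^T&\mathbf 0\end{pmatrix}\in\mathbb R^{(2m+k)\times(2m+k)}.$$ *)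

(* Defs.v *)
From HB Require Import structures.
From mathcomp Require Import all_boot all_order all_algebra.
From mathcomp Require Import polyrcf.

Set Implicit Arguments.
Unset Strict Implicit.
Unset Printing Implicit Defensive.

Import Order.TTheory GRing.Theory Num.Theory.
Local Open Scope ring_scope.

Definition symposdef (R : rcfType) (p : nat) (A : 'M[R]_p) : Prop :=
  A^T = A /\ forall x : 'cV[R]_p, x != 0 -> 0 < (x^T *m A *m x) 0 0.

(* The real eigenvalues of [A] in nondecreasing order, each one repeated
   according to its (algebraic) multiplicity. *)
Definition spectrum (R : rcfType) (p : nat) (A : 'M[R]_p) : seq R :=
  sort <=%R
    (flatten [seq nseq (mup x (char_poly A)) x | x <- rootsR (char_poly A)]).

Definition pos_spectrum (R : rcfType) (p : nat) (A : 'M[R]_p) : seq R :=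
  [seq x <- spectrum A | 0 < x].

Definition neg_spectrum (R : rcfType) (p : nat) (A : 'M[R]_p) : seq R :=
  [seq x <- spectrum A | x < 0].

(* Signed numbering of the nonzero eigenvalues:
     ... <= lambda A (-2) <= lambda A (-1) < 0 < lambda A 1 <= lambda A 2 <= ...
   Note that [Negz i] is the integer -(i+1). The value is 0 at index 0 and at
   indices that exceed the number of eigenvalues of the given sign. *)
Definition lambda (R : rcfType) (p : nat) (A : 'M[R]_p) (k : int) : R :=
  match k with
  | Posz 0 => 0
  | Posz i.+1 => nth 0 (pos_spectrum A) i
  | Negz i => nth 0 (rev (neg_spectrum A)) i
  end.

Lemma sum_block_sizes (N n : nat) : (\sum_(i < N.+1) n = N.+1 * n)%N.
Proof. by rewrite sum_nat_const card_ord. Qed.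

Definition square_of_blocks (R : rcfType) (N n : nat)
    (E : 'I_N.+1 -> 'I_N.+1 -> 'M[R]_n) : 'M[R]_(N.+1 * n) :=
  castmx (sum_block_sizes N n, sum_block_sizes N n)
    (\mxblock_(i < N.+1, j < N.+1) E i j).

(* diag(B, Q_1, ..., Q_N), where [Q i] stands for Q_(i+1). [unlift ord0 i] is
   [None] for i = 0 and [Some i'] with i = i' + 1 otherwise. *)
Definition Dmx (R : rcfType) (N n : nat) (B : 'M[R]_n) (Q : 'I_N -> 'M[R]_n) :
    'M[R]_(N.+1 * n) :=
  square_of_blocks (fun i j : 'I_N.+1 =>
    if i == j then (if unlift ord0 i is Some i' then Q i' else B) else 0).

(* Block (i' + 1, i') is - M i'. *)
Definition Lmx (R : rcfType) (N n : nat) (M : 'I_N -> 'M[R]_n) :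
    'M[R]_(N.+1 * n) :=
  square_of_blocks (fun i j : 'I_N.+1 =>
    if i == j then 1%:M
    else if unlift ord0 i is Some i' then
           (if i' == j :> nat then - M i' else 0)
         else 0).

Definition A3 (R : rcfType) (m k : nat) (D L : 'M[R]_m) (Rk : 'M[R]_k)
    (H : 'M[R]_(k, m)) : 'M[R]_(m + (k + m)) :=
  block_mx D                (row_mx 0 L)
           (col_mx 0 L^T)   (block_mx Rk H H^T 0).

Definition extend_R (R : rcfType) (k : nat) (Rk : 'M[R]_k) (r : 'cV[R]_k)
    (alpha : R) : 'M[R]_(k + 1) :=
  block_mx Rk r r^T alpha%:M.

Definition extend_H (R : rcfType) (m k : nat) (H : 'M[R]_(k, m))
    (h : 'cV[R]_m) : 'M[R]_(k + 1, m) :=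
  col_mx H h^T.

(* Main.v *)
(* The matrix for k observations is a principal submatrix of the one for k + 1
   observations, so Cauchy interlacing gives s'_i <= s_i <= s'_(i+1) for the
   sorted spectra s of A and s' of A'. Both matrices have exactly m negative
   eigenvalues and none equal to 0, because the coordinate subspace z = 0 is
   positive and {(- D^-1 L z, 0, z)} is negative. The m smallest eigenvalues are
   therefore the negative ones, and the four inequalities are interlacing at the
   indices 0, m - 1, the last one, and m. Interlacing and inertia both follow
   from one count: after diagonalization over R[i], a subspace on which
   a A + b is negative has dimension at most the number of eigenvalues x with
   a x + b < 0. *)

Require Import Defs.
From HB Require Import structures.
From mathcomp Require Import all_boot all_order all_algebra.
From mathcomp Require Import complex polyrcf zify ring.

Set Implicit Arguments.
Unset Strict Implicit.
Unset Printing Implicit Defensive.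

Import Order.TTheory GRing.Theory Num.Theory.
Local Open Scope ring_scope.
Local Open Scope sesquilinear_scope.

(** * Hermitian forms and the dimension of a negative subspace *)

Definition qform (C : numClosedFieldType) (p : nat) (A : 'M[C]_p)
    (v : 'rV[C]_p) : C :=
  (v *m A *m v ^t*) 0 0.

Lemma qform_diag (C : numClosedFieldType) (p : nat) (d v : 'rV[C]_p) :
  qform (diag_mx d) v = \sum_i d 0 i * `|v 0 i| ^+ 2.
Proof.
rewrite /qform mxE; apply: eq_bigr => i _.
by rewrite mul_mx_diag !mxE normCK mulrA [d 0 i * _]mulrC.
Qed.

(** Vectors are rows, so the vectors [v *m U] run over the row space of [U]; the form restricted to
    that subspace is given by the compressed matrix. *)
Lemma qform_mul (C : numClosedFieldType) (q p : nat) (A : 'M[C]_p)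
    (U : 'M[C]_(q, p)) (v : 'rV[C]_q) :
  qform A (v *m U) = qform (U *m A *m U ^t*) v.
Proof. by rewrite /qform trmx_mul map_mxM !mulmxA. Qed.

(** The stacked matrix has trivial left kernel, so its rank is its number of rows, and rank is at
    most the number of columns. *)
Lemma leq_add_independent (F : fieldType) (q s p : nat) (U : 'M[F]_(q, p))
    (W : 'M[F]_(s, p)) :
  (forall x y, x *m U = y *m W -> x = 0 /\ y = 0 :> 'rV[F]__) ->
  (q + s <= p)%N.
Proof.
move=> UW; suff: row_free (col_mx U W) by move/eqP <-; apply: rank_leq_col.
rewrite -kermx_eq0; apply/eqP/row_matrixP => i; rewrite row0.
have /sub_kermxP := row_sub i (kermx (col_mx U W)).
move: (row i _) => v; rewrite -[v]hsubmxK mul_row_col => /eqP.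
rewrite addr_eq0 -mulNmx => /eqP /UW[-> /eqP]; rewrite oppr_eq0 => /eqP ->.
by rewrite row_mx0.
Qed.

(* If the diagonal form [d] is negative on a [q]-dimensional space, that space
   meets the span of the coordinates with [d i >= 0] trivially. *)
Lemma card_neg_diag (C : numClosedFieldType) (q p : nat) (d : 'rV[C]_p)
    (U : 'M[C]_(q, p)) :
  (forall i, d 0 i \is Num.real) ->
  (forall x, x != 0 -> qform (diag_mx d) (x *m U) < 0) ->
  (q <= #|[pred i | (d 0 i < 0)%R]|)%N.
Proof.
move=> dR Uneg; set S := [pred i | d 0 i < 0].
(* The rows of [W] are the standard basis vectors at the coordinates outside [S]. *)
pose W : 'M[C]_(#|[predC S]|, p) := rowsub (fun j => enum_val j) 1%:M.
have WE (y : 'rV[C]_#|[predC S]|) i :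
    (y *m W) 0 i = \sum_j y 0 j * (enum_val j == i)%:R.
  by rewrite mxE; apply: eq_bigr => j _; rewrite !mxE.
have W0 (y : 'rV_#|[predC S]|) i : S i -> (y *m W) 0 i = 0.
  move=> Si; rewrite WE big1 // => j _; case: eqP => [ji|]; last by rewrite mulr0.
  by have := enum_valP j; rewrite ji => /negP[].
have WV (y : 'rV_#|[predC S]|) j : (y *m W) 0 (enum_val j) = y 0 j.
  rewrite WE (bigD1 j) //= eqxx mulr1 big1 ?addr0 // => k kj.
  by rewrite (inj_eq enum_val_inj) (negPf kj) mulr0.
have : (q + #|[predC S]| <= p)%N.
  apply: (@leq_add_independent _ _ _ _ U W) => x y xy.
  have x0 : x = 0.
    apply: contraTeq isT => /Uneg; rewrite xy qform_diag => /lt_geF /negP[].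
    apply: sumr_ge0 => i _; have [Si|Si] := boolP (S i).
      by rewrite W0 // normr0 expr0n mulr0.
    by rewrite mulr_ge0 ?exprn_ge0 // real_leNgt.
  by split=> //; apply/rowP => j; rewrite mxE -WV -xy x0 mul0mx mxE.
by rewrite -[X in (_ <= X)%N]card_ord -(cardC S) leq_add2r.
Qed.

(** * Spectrum of a real symmetric matrix by unitary diagonalization *)

Lemma char_poly_conj (F : fieldType) (p : nat) (P A : 'M[F]_p) :
  P \in unitmx -> char_poly (invmx P *m A *m P) = char_poly A.
Proof.
move=> uP; rewrite /char_poly /char_poly_mx !map_mxM.
have <- : map_mx polyC (invmx P) *m ('X%:M - map_mx polyC A) *m map_mx polyC P
       = 'X%:M - map_mx polyC (invmx P) *m map_mx polyC A *m map_mx polyC P.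
  rewrite mulmxBr mulmxBl; congr (_ - _).
  by rewrite mul_mx_scalar -scalemxAl -map_mxM mulVmx // map_mx1 scalemx1.
rewrite !det_mulmx mulrAC -det_mulmx -map_mxM mulVmx // map_mx1.
by rewrite det1 mul1r.
Qed.

Section Real.
Variable R : rcfType.
Local Notation toC := (real_complex R).
Local Notation "A ^C" := (map_mx toC A).

(** Both lists contain each x as often as its multiplicity as a root of the characteristic
    polynomial. *)
Lemma perm_spectrum (p : nat) (A : 'M[R]_p) (s : seq R) :
  char_poly A = \prod_(x <- s) ('X - x%:P) -> perm_eq (spectrum A) s.
Proof.
move=> As; rewrite /spectrum perm_sort; apply/allP => x _ /=; apply/eqP.
have pn0 : char_poly A != 0 by apply/monic_neq0/char_poly_monic.
rewrite count_flatten -map_comp.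
have rootE y : (y \in rootsR (char_poly A)) = root (char_poly A) y.
  by rewrite -(roots_on_rootsR pn0) in_itv.
rewrite -mu_prod_XsubC -As.
have ur : uniq (rootsR (char_poly A)) by apply: uniq_roots.
have [xr|xr] := boolP (x \in rootsR (char_poly A)).
  rewrite sumnE big_map (bigD1_seq x) //= count_nseq /= eqxx mul1n big1 ?addn0 //.
  by move=> y yx; rewrite count_nseq /= (negPf yx).
rewrite mupNroot -?rootE // sumnE big_map big_seq big1 // => y yr.
rewrite /= count_nseq /=; case: eqP => // yx; by rewrite yx (negPf xr) in yr.
Qed.

Lemma trC_map (m n : nat) (A : 'M[R]_(m, n)) : (A^C) ^t* = (A^T)^C.
Proof. by apply/matrixP => i j; rewrite !mxE; apply: conjc_real. Qed.

Lemma real_spectral (p : nat) (A : 'M[R]_p) : A^T = A ->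
  exists2 P : 'M[R[i]]_p, P \is unitarymx &
  exists2 r : 'rV[R]_p, A^C = P ^t* *m diag_mx r^C *m P &
    perm_eq (spectrum A) [seq r 0 i | i <- enum 'I_p].
Proof.
move=> symA.
have hA : A^C \is hermsymmx.
  by apply/is_hermitianmxP; rewrite expr0 scale1r trC_map symA.
have := hermitian_normalmx hA => /orthomx_spectralP AE.
have dR := hermitian_spectral_diag_real hA.
have uP := spectral_unitarymx A^C; move: AE dR uP.
move: (spectralmx _) (spectral_diag _) => P d AE /mxOverP dR uP.
pose r := map_mx (@complex.Re R) d.
have dr : d = r^C by apply/rowP => i; rewrite !mxE RRe_real.
exists P => //; exists r; first by rewrite -dr -invmx_unitary.
(* The factorization is proved over [R[i]] and descends to [R] because the embedding of polynomials
   is injective. *)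
apply: perm_spectrum; apply: (@map_poly_inj _ _ toC).
rewrite map_char_poly AE char_poly_conj ?unitarymx_unit //.
rewrite char_poly_trig ?diag_mx_is_trig // rmorph_prod big_map /= big_enum.
by apply: eq_bigr => i _ /=; rewrite map_polyXsubC dr !mxE eqxx mulr1n.
Qed.

Lemma size_spectrum (p : nat) (A : 'M[R]_p) : A^T = A -> size (spectrum A) = p.
Proof.
move=> /real_spectral[P _ [r _ /perm_size ->]].
by rewrite size_map size_enum_ord.
Qed.

Lemma sorted_spectrum (p : nat) (A : 'M[R]_p) : sorted <=%R (spectrum A).
Proof. by apply: sort_sorted; apply: le_total. Qed.

(** The affine form covers every count in use: a = 1, b = -c counts eigenvalues below c; a = -1, b =
    c counts those above c; b = 0 counts by sign. *)
Lemma count_spectrum_affine (p : nat) (A : 'M[R]_p) (a b : R) : A^T = A ->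
  exists2 P : 'M[R[i]]_p, P \is unitarymx &
  exists2 d : 'rV[R[i]]_p, (a *: A + b%:M)^C = P ^t* *m diag_mx d *m P &
    (forall i, d 0 i \is Num.real) /\
    count (fun x => a * x + b < 0) (spectrum A) = #|[pred i | (d 0 i < 0)%R]|.
Proof.
move=> /real_spectral[P uP [r AE /permP ->]].
exists P => //; exists (map_mx toC (\row_i (a * r 0 i + b))).
  have -> : map_mx toC (\row_i (a * r 0 i + b)) =
            toC a *: map_mx toC r + const_mx (toC b).
    by apply/rowP => i; rewrite !mxE rmorphD rmorphM.
  rewrite map_mxD map_mxZ map_scalar_mx AE linearD linearZ /= diag_const_mx.
  rewrite mulmxDr mulmxDl -scalemxAr -scalemxAl; congr (_ + _).
  rewrite mul_mx_scalar -scalemxAl -invmx_unitary // mulVmx ?scalemx1 //.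
  exact: unitarymx_unit.
split=> [i|]; first by rewrite !mxE complex_real.
rewrite count_map -sum1_count -sum1_card big_enum_cond /=.
apply: eq_bigl => i; rewrite !inE !mxE.
by rewrite -(ltcR (a * r 0 i + b) 0).
Qed.

(** * Eigenvalue counts as maximal dimensions of negative subspaces *)

Lemma leq_count_spectrum (q p : nat) (A : 'M[R]_p) (a b : R)
    (U : 'M[R[i]]_(q, p)) : A^T = A ->
  (forall x, x != 0 -> qform (a *: A + b%:M)^C (x *m U) < 0) ->
  (q <= count (fun x => (a * x + b < 0)%R) (spectrum A))%N.
Proof.
move=> /(count_spectrum_affine a b)[P uP [d -> [dR ->]]] Uneg.
(* In eigenvector coordinates the subspace is spanned by [U *m P ^t*] and the form is diagonal. *)
apply: (@card_neg_diag _ _ _ _ (U *m P ^t*)) => // x /Uneg.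
by rewrite mulmxA qform_mul trmxCK.
Qed.

(** The bound of [leq_count_spectrum] is attained by the span of the eigenvectors, that is rows of
    [P], whose entry of [d] is negative. *)
Lemma negative_subspace (p : nat) (A : 'M[R]_p) (a b : R) : A^T = A ->
  exists U : 'M[R[i]]_(count (fun x => a * x + b < 0) (spectrum A), p),
    forall x, x != 0 -> qform (a *: A + b%:M)^C (x *m U) < 0.
Proof.
move=> /(count_spectrum_affine a b)[P uP [d -> [dR ->]]].
set S := [pred i | _].
exists (rowsub (fun j : 'I_#|S| => enum_val j) 1%:M *m P) => x xn0.
set W := rowsub _ _.
rewrite mulmxA qform_mul !mulmxA mulmxtVK //.
have -> : P *m P ^t* = 1%:M by apply/unitarymxP.
rewrite mul1mx qform_mul.
have -> : W *m diag_mx d *m W ^t* = diag_mx (\row_j d 0 (enum_val j)).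
  apply/matrixP => j k; rewrite mul_mx_diag !mxE (bigD1 (enum_val k)) //=.
  rewrite !mxE eqxx conjC1 mulr1 big1 ?addr0 => [|i ik].
    by rewrite (inj_eq enum_val_inj); case: eqP => [->|]; rewrite ?mul1r ?mul0r.
  by rewrite !mxE [_ k == i]eq_sym (negPf ik) conjC0 mulr0.
rewrite qform_diag.
have /rV0Pn[j xj] := xn0.
(* A nonzero coordinate contributes a strictly negative term, and the others contribute at most
   zero. *)
rewrite (bigD1 j) //= -[X in _ < X]addr0 ltr_leD //.
  by rewrite mxE pmulr_llt0 ?exprn_gt0 ?normr_gt0 //; apply: (enum_valP j).
apply: sumr_le0 => i _; rewrite mxE mulr_le0_ge0 ?exprn_ge0 //.
by apply/ltW/(enum_valP i).
Qed.

(** * Compressions and Cauchy interlacing *)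

Lemma count_spectrum_compress (p p' : nat) (A' : 'M[R]_p') (J : 'M[R]_(p, p'))
    (a b : R) : A'^T = A' -> J *m J^T = 1%:M ->
  (count (fun x => (a * x + b < 0)%R) (spectrum (J *m A' *m J^T)) <=
   count (fun x => (a * x + b < 0)%R) (spectrum A'))%N.
Proof.
move=> symA' JJ; set A := J *m A' *m J^T.
have symA : A^T = A by rewrite !trmx_mul trmxK symA' mulmxA.
have [U Uneg] := negative_subspace a b symA.
(* [J] carries a negative subspace for the compression to one for [A']: the form keeps its values,
   and the shift by b survives because [J *m J^T = 1%:M]. *)
apply: (@leq_count_spectrum _ _ _ _ _ (U *m J^C)) => // x /Uneg.
rewrite mulmxA [X in _ -> X < 0]qform_mul trC_map -!map_mxM.
rewrite mulmxDr mulmxDl -scalemxAr -scalemxAl.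
by rewrite mul_mx_scalar -scalemxAl JJ scalemx1.
Qed.

(** Otherwise, with c the i-th entry for [A'], the compression has at least i + 1 eigenvalues below
    c, while [A'] has at most i. *)
Lemma cauchy_interlacing_lower (p p' : nat) (A' : 'M[R]_p') (J : 'M[R]_(p, p'))
    (i : nat) : A'^T = A' -> J *m J^T = 1%:M -> (i < p)%N ->
  (spectrum A')`_i <= (spectrum (J *m A' *m J^T))`_i.
Proof.
move=> symA' JJ ip; set A := J *m A' *m J^T; rewrite leNgt.
apply/negP => lt_i.
have symA : A^T = A by rewrite !trmx_mul trmxK symA' mulmxA.
set c := (spectrum A')`_i in lt_i.
have := count_spectrum_compress 1 (- c) symA' JJ.
have /eq_count cE : (fun x => 1 * x - c < 0) =1 (< c).
  by move=> x; rewrite mul1r subr_lt0.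
rewrite -/A !cE.
apply/negP; rewrite -ltnNge.
apply: (@leq_ltn_trans i).
  rewrite leqNgt; apply/negP => /(nth_count_lt 0 (sorted_spectrum A')).
  by rewrite ltxx.
rewrite ltnNge; apply/negP => ci.
have : c <= (spectrum A)`_i.
  by apply: nth_count_ge (sorted_spectrum A) _; rewrite ci size_spectrum.
by rewrite leNgt lt_i.
Qed.

(** The shift p' - p leaves equally many entries after both positions. If the bound failed, with c
    the entry for [A'], the compression would have at least p - i eigenvalues above c, but [A'] has
    at most p - i - 1. *)
Lemma cauchy_interlacing_upper (p p' : nat) (A' : 'M[R]_p') (J : 'M[R]_(p, p'))
    (i : nat) : A'^T = A' -> J *m J^T = 1%:M -> (i < p)%N -> (p <= p')%N ->
  (spectrum (J *m A' *m J^T))`_i <= (spectrum A')`_(i + (p' - p)).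
Proof.
move=> symA' JJ ip pp'; set A := J *m A' *m J^T; rewrite leNgt.
apply/negP => lt_i.
have symA : A^T = A by rewrite !trmx_mul trmxK symA' mulmxA.
set j := (i + (p' - p))%N in lt_i; set c := (spectrum A')`_j in lt_i.
have := count_spectrum_compress (-1) c symA' JJ.
have /eq_count cE : (fun x => -1 * x + c < 0) =1 (> c).
  by move=> x; rewrite mulN1r addrC subr_lt0.
rewrite -/A !cE.
have leE s : count (<= c) s = (size s - count (> c) s)%N by exact: count_le_gt.
have : (j < count (<= c) (spectrum A'))%N.
  rewrite ltnNge; apply/negP => ci.
  suff : c < (spectrum A')`_j by rewrite ltxx.
  apply: nth_count_gt (sorted_spectrum A') _; rewrite ci size_spectrum //.
  by rewrite /j -[X in (_ < X)%N](subnKC pp') ltn_add2r.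
have : (count (<= c) (spectrum A) <= i)%N.
  rewrite leqNgt; apply/negP => /(nth_count_le 0 (sorted_spectrum A)).
  by rewrite leNgt lt_i.
have : (count (> c) (spectrum A) <= p)%N.
  by rewrite -{2}(size_spectrum symA) count_size.
rewrite !leE !size_spectrum // /j.
by move: (count _ _) (count _ _) => u v; lia.
Qed.

(** * Positive definite matrices and sign counts *)

Lemma qform_gt0 (p : nat) (S : 'M[R]_p) (v : 'rV[R[i]]_p) :
  symposdef S -> v != 0 -> 0 < qform S^C v.
Proof.
move=> [symS Spos] vn0.
pose a := map_mx (@complex.Re R) v; pose b := map_mx (@complex.Im R) v.
have vE : v = a^C + 'i%C *: b^C by apply/rowP => i; rewrite !mxE -complexE.
have vtE : v ^t* = (a^T)^C - 'i%C *: (b^T)^C.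
  apply/colP => i; rewrite !mxE; case: (v 0 i) => x y /=.
  by apply/eqP; rewrite eq_complex /=; apply/andP; split; apply/eqP; simpc.
have -> : qform S^C v = toC ((a *m S *m a^T) 0 0 + (b *m S *m b^T) 0 0).
  (* A 1 x 1 matrix is its own transpose; with [S] symmetric, this cancels the cross terms of a +
     ib. *)
  have ab : a *m S *m b^T = b *m S *m a^T.
    rewrite [LHS]mx11_scalar -tr_scalar_mx -mx11_scalar.
    by rewrite !trmx_mul trmxK symS mulmxA.
  rewrite /qform vtE {1}vE !mulmxDl !mulmxBr -!scalemxAl -!scalemxAr -!map_mxM.
  rewrite ab; move: (a *m _ *m _) (b *m _ *m b^T) (b *m _ *m _) => u w z.
  by rewrite scalerA -expr2 sqr_i !mxE rmorphD; ring.
(* The equality case is recorded so that a zero sum forces both the real and the imaginary part to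
   vanish. *)
have pos (y : 'rV[R]_p) : 0 <= (y *m S *m y^T) 0 0 ?= iff (y == 0).
  split.
    have [->|yn0] := eqVneq y 0; first by rewrite !mul0mx mxE.
    by have := Spos y^T; rewrite trmxK trmx_eq0 => /(_ yn0)/ltW.
  have [->|yn0] := eqVneq y 0; first by rewrite !mul0mx mxE eqxx.
  by have := Spos y^T; rewrite trmxK trmx_eq0 => /(_ yn0)/lt_eqF.
rewrite -[0]/(toC 0) ltcR lt0r addr_ge0 ?pos ?andbT //.
rewrite paddr_eq0 ?pos // ![_ == 0]eq_sym !pos.
apply: contra vn0 => /andP[/eqP a0 /eqP b0].
by rewrite vE a0 b0 !map_mx0 scaler0 addr0.
Qed.

(** One half of Sylvester's law of inertia, for positive eigenvalues with a = 1 and negative ones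
    with a = -1. Definiteness on real combinations of the rows extends to complex ones by
    [qform_gt0]. *)
Lemma sylvester_leq (q p : nat) (A : 'M[R]_p) (a : R) (U : 'M[R]_(q, p)) :
  A^T = A -> symposdef (a *: (U *m A *m U^T)) ->
  (q <= count (fun x => (0 < a * x)%R) (spectrum A))%N.
Proof.
move=> symA Upos.
rewrite (@eq_count _ _ (fun x => - a * x + 0 < 0)); last first.
  by move=> x; rewrite addr0 mulNr oppr_lt0.
apply: (@leq_count_spectrum _ _ _ _ _ U^C) => // x /(qform_gt0 Upos).
rewrite qform_mul trC_map -!map_mxM /qform raddf0 addr0 scaleNr mulmxN mulNmx.
rewrite map_mxN -scalemxAr -scalemxAl mulmxN mulNmx [X in _ -> X < 0]mxE.
by rewrite oppr_lt0.
Qed.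

Lemma symposdef_congr (q p : nat) (S : 'M[R]_p) (M : 'M[R]_(p, q)) :
  symposdef S -> (forall x : 'cV_q, M *m x = 0 -> x = 0) ->
  symposdef (M^T *m S *m M).
Proof.
move=> [symS Spos] Minj; split=> [|x xn0].
  by rewrite !trmx_mul trmxK symS mulmxA.
have /Spos : M *m x != 0 by apply: contra_neq xn0 => /Minj.
by rewrite trmx_mul !mulmxA.
Qed.

Lemma symposdef_block (p q : nat) (S : 'M[R]_p) (T : 'M[R]_q) :
  symposdef S -> symposdef T -> symposdef (block_mx S 0 0 T).
Proof.
have ge0 s (M : 'M[R]_s) (x : 'cV_s) : symposdef M -> 0 <= (x^T *m M *m x) 0 0.
  move=> [_ Mpos]; have [->|/Mpos/ltW //] := eqVneq x 0.
  by rewrite mulmx0 mxE.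
move=> hS hT; split=> [|x].
  by rewrite tr_block_mx !trmx0 hS.1 hT.1.
rewrite -[x]vsubmxK; move: (usubmx x) (dsubmx x) => y z yz0.
rewrite tr_col_mx mul_row_block !mulmx0 addr0 add0r mul_row_col mxE.
have [y0|/hS.2 ypos] := eqVneq y 0; last exact: ltr_pwDl (ge0 _ _ z hT).
rewrite ltr_wpDl ?ge0 //; apply: hT.2; apply: contra_neq yz0 => ->.
by rewrite y0 col_mx0.
Qed.

Lemma symposdef_unit (p : nat) (S : 'M[R]_p) : symposdef S -> S \in unitmx.
Proof.
move=> [_ Spos]; rewrite -row_free_unit -kermx_eq0.
apply/eqP/row_matrixP => i; rewrite row0; apply/eqP.
have /sub_kermxP := row_sub i (kermx S); move: (row i _) => u uS.
apply/negPn/negP => un0; have := Spos u^T; rewrite trmx_eq0 trmxK uS mul0mx mxE.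
by move=> /(_ un0); rewrite ltxx.
Qed.

Lemma symposdef_cast (p q : nat) (e : p = q) (S : 'M[R]_p) :
  symposdef S -> symposdef (castmx (e, e) S).
Proof. by case: q / e. Qed.

Lemma unitmx_cast (p q : nat) (e : p = q) (S : 'M[R]_p) :
  (castmx (e, e) S \in unitmx) = (S \in unitmx).
Proof. by case: q / e. Qed.

(** * The block matrices D and L *)

Lemma symposdef_Dmx (N n : nat) (B : 'M[R]_n) (Q : 'I_N -> 'M[R]_n) :
  symposdef B -> (forall i, symposdef (Q i)) -> symposdef (Dmx B Q).
Proof.
move=> hB hQ; apply: symposdef_cast.
pose E (i : 'I_N.+1) := if unlift ord0 i is Some i' then Q i' else B.
have hE i : symposdef (E i) by rewrite /E; case: unlift.
split=> [|x xn0].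
  rewrite tr_mxblock; apply: eq_mxblock => i j.
  by rewrite eq_sym; case: eqP => [->|]; rewrite ?trmx0 // (hE j).1.
rewrite -[x]submxcolK tr_mxcol mul_mxrow_mxblock mul_mxrow_mxcol summxE.
(* Only diagonal blocks survive, so the form is a sum of nonnegative block forms, and it vanishes
   only if every block of [x] does. *)
have -> : \sum_j ((\sum_i (submxcol x i)^T *m
                     (if i == j then E i else 0)) *m submxcol x j) 0 0 =
          \sum_j ((submxcol x j)^T *m E j *m submxcol x j) 0 0.
  apply: eq_bigr => j _; rewrite (bigD1 j) //= eqxx big1 ?addr0 // => i /negPf->.
  by rewrite mulmx0.
have ge0 j (y : 'cV_n) : 0 <= (y^T *m E j *m y) 0 0.
  have [->|/(hE j).2/ltW //] := eqVneq y 0; by rewrite mulmx0 mxE.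
rewrite lt0r sumr_ge0 ?andbT //; apply: contra_neq xn0 => /eqP.
rewrite psumr_eq0 // => /allP x0; rewrite -[x]submxcolK.
apply/eqP; rewrite -mxcol0; apply/eqP/eq_mxcol => j; apply/eqP.
apply: contraTT (x0 j (mem_index_enum j)) => /(hE j).2 /=.
by rewrite lt0r => /andP[].
Qed.

(** The matrix is lower triangular with ones on the diagonal, so its determinant is 1 whatever the
    blocks [M]. *)
Lemma unitmx_Lmx (N n : nat) (M : 'I_N -> 'M[R]_n) : Lmx M \in unitmx.
Proof.
rewrite unitmx_cast unitmxE det_trig; last first.
  apply/is_trig_mxblockP; split=> [i j ij|i]; last first.
    by rewrite eqxx; apply/is_trig_mxP => a b ab; rewrite mxE -val_eqE ltn_eqF.
  rewrite -val_eqE ltn_eqF //; case: unliftP => // i' ii'.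
  by case: eqP => // ij'; move: ij; rewrite ii' lift0 ij' ltnNge leqnSn.
by rewrite big1 ?unitr1 // => s _; rewrite !mxE eqxx mxE eqxx.
Qed.

(** * Inertia of the saddle point matrix and positions of its eigenvalues *)

Section Saddle.
Variables (m k : nat) (D L : 'M[R]_m) (S : 'M[R]_k) (H : 'M[R]_(k, m)).
Hypotheses (hD : symposdef D) (hS : symposdef S) (uL : L \in unitmx).
Let A := A3 D L S H.

Lemma tr_A3 : A^T = A.
Proof.
rewrite /A /A3 !tr_block_mx tr_row_mx tr_col_mx !trmx0 !trmxK.
by rewrite hD.1 hS.1.
Qed.

(* [D] and [S] sit on the coordinate subspace [z = 0]. *)
Lemma leq_count_pos_A3 : (m + k <= count (fun x => (0 < x)%R) (spectrum A))%N.
Proof.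
rewrite (@eq_count _ _ (fun x => 0 < 1 * x)); last by move=> x; rewrite mul1r.
pose U : 'M[R]_(m + k, m + (k + m)) := block_mx 1%:M 0 0 (row_mx 1%:M 0).
apply: (@sylvester_leq _ _ _ _ U tr_A3).
rewrite scale1r /U /A /A3 tr_block_mx tr_row_mx !trmx0 !trmx1.
rewrite mulmx_block !mul1mx !mul0mx !addr0 add0r.
rewrite mul_row_col mul_row_block !mul0mx !mul1mx !addr0.
rewrite mulmx_block !mulmx1 !mulmx0 !addr0 !mul_row_col !mulmx1 !mulmx0 !addr0.
by rewrite !add0r mul_row_col mulmx1 mulmx0 addr0; apply: symposdef_block.
Qed.

(* On the vectors [(- D^-1 L z, 0, z)] the form of [A] is [- z^T L^T D^-1 L z]. *)
Lemma leq_count_neg_A3 : (m <= count (fun x => (x < 0)%R) (spectrum A))%N.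
Proof.
rewrite (@eq_count _ _ (fun x => 0 < -1 * x)); last first.
  by move=> x; rewrite mulN1r oppr_gt0.
have uD := symposdef_unit hD.
pose M := invmx D *m L.
pose U : 'M[R]_(m, m + (k + m)) := row_mx (- M^T) (row_mx 0 1%:M).
apply: (@sylvester_leq _ _ _ _ U tr_A3).
have -> : -1 *: (U *m A *m U^T) = M^T *m D *m M.
  have MD : M^T *m D = L^T by rewrite trmx_mul trmx_inv hD.1 mulmxKV.
  rewrite /U /A /A3 !tr_row_mx trmx0 trmx1 linearN /= trmxK.
  rewrite mul_row_block mul_mx_row mulmx0 !mul_row_col.
  rewrite !mul0mx !mul1mx !add0r !mulNmx MD addNr mul0mx add0r.
  rewrite add_row_mx mul_row_col mulmx0 mulmx1 add0r addr0 scaleN1r opprK.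
  by rewrite -MD mulmxA mulmxK // ?mulmxA.
(* [M] is injective because [D] and [L] are invertible. *)
apply: symposdef_congr => // x; rewrite /M -mulmxA => /(congr1 (mulmx D)).
rewrite mulKVmx // mulmx0 => /(congr1 (mulmx (invmx L))).
by rewrite mulKmx // mulmx0.
Qed.

(** At least m + k positive and m negative eigenvalues exhaust the size 2m + k, so both bounds are
    equalities and 0 is not an eigenvalue. The strict count gives the negative prefix of the sorted
    list, the weak one the positive suffix. *)
Lemma inertia_A3 : count (< 0) (spectrum A) = m /\ count (<= 0) (spectrum A) = m.
Proof.
have le1 := leq_count_pos_A3; have le2 := leq_count_neg_A3.
have sz := size_spectrum tr_A3.
have leE : count (<= 0) (spectrum A) =
           (size (spectrum A) - count (> 0)%R (spectrum A))%N.
  exact: count_le_gt.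
have le3 : (count (< 0)%R (spectrum A) <= count (<= 0)%R (spectrum A))%N.
  by apply: sub_count => x /= /ltW.
suff : count (<= 0) (spectrum A) = m.
  move=> le4; split=> //; apply/eqP.
  by rewrite eqn_leq le2 -[X in (_ <= X)%N]le4 le3.
apply/eqP; rewrite eqn_leq (leq_trans le2 le3) andbT leE sz.
by move: (count _ _) le1 => u; lia.
Qed.

Lemma neg_spectrum_A3 : neg_spectrum A = take m (spectrum A).
Proof.
by rewrite /neg_spectrum sorted_filter_lt ?sorted_spectrum // inertia_A3.1.
Qed.

Lemma pos_spectrum_A3 : pos_spectrum A = drop m (spectrum A).
Proof.
by rewrite /pos_spectrum sorted_filter_gt ?sorted_spectrum // inertia_A3.2.
Qed.

Lemma size_neg_spectrum_A3 : size (neg_spectrum A) = m.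
Proof.
by rewrite neg_spectrum_A3 size_takel // size_spectrum ?tr_A3 ?leq_addr.
Qed.

Lemma size_pos_spectrum_A3 : size (pos_spectrum A) = (m + k)%N.
Proof.
by rewrite pos_spectrum_A3 size_drop size_spectrum ?tr_A3 // addKn addnC.
Qed.

(** Negative indices count backwards from zero: -1 is at position m - 1 and -m at position 0. *)
Lemma lambda_neg_A3 (i : nat) :
  (i < m)%N -> lambda A (- i.+1%:Z) = (spectrum A)`_(m - i.+1).
Proof.
move=> im; rewrite -NegzE /= nth_rev ?size_neg_spectrum_A3 //.
by rewrite neg_spectrum_A3 nth_take // ltn_subrL (leq_trans _ im).
Qed.

Lemma lambda_pos_A3 (i : nat) : lambda A i.+1%:Z = (spectrum A)`_(m + i).
Proof. by rewrite /= pos_spectrum_A3 nth_drop. Qed.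

End Saddle.

(** * Adding one observation *)

Lemma A3_compress (m k : nat) (D L : 'M[R]_m) (S : 'M[R]_k) (H : 'M[R]_(k, m))
    (r : 'cV[R]_k) (alpha : R) (h : 'cV[R]_m) :
  exists2 J : 'M[R]_(m + (k + m), m + (k + 1 + m)), J *m J^T = 1%:M &
    A3 D L S H = J *m A3 D L (extend_R S r alpha) (extend_H H h) *m J^T.
Proof.
(* [J] is the identity matrix without the row of the new observation, so its rows are
   orthonormal. *)
exists (block_mx 1%:M 0 0 (block_mx (row_mx 1%:M 0) 0 0 1%:M)).
  rewrite !tr_block_mx tr_row_mx !trmx0 !trmx1 !mulmx_block mul_row_col.
  rewrite !mul0mx !mulmx0 !mulmx1 !addr0 !add0r.
  by rewrite -!scalar_mx_block.
rewrite /A3 /extend_R /extend_H !tr_block_mx tr_row_mx !trmx0 !trmx1.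
rewrite tr_col_mx trmxK !mulmx_block.
rewrite !(mul0mx, mulmx0, mul1mx, mulmx1, addr0, add0r).
rewrite !(mul_row_col, mul_mx_row, mul_row_block).
rewrite !(mul0mx, mulmx0, mul1mx, mulmx1, addr0, add0r).
rewrite !add_row_mx mul_block_col mulmx_block !mul_row_col.
by rewrite !(mul0mx, mulmx0, mul1mx, mulmx1, addr0, add0r).
Qed.
End Real.

Theorem theorem3 (R : rcfType) (N n : nat) (hN : (1 <= N)%N) (hn : (1 <= n)%N)
    (B : 'M[R]_n) (Q M : 'I_N -> 'M[R]_n)
    (hB : symposdef B) (hQ : forall i, symposdef (Q i))
    (k : nat) (hk : (k < N.+1 * n)%N)
    (Rk : 'M[R]_k) (Hk : 'M[R]_(k, N.+1 * n)) (hRk : symposdef Rk)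
    (r : 'cV[R]_k) (alpha : R) (h : 'cV[R]_(N.+1 * n))
    (halpha : 0 < alpha) (hRk1 : symposdef (extend_R Rk r alpha)) :
  let m := (N.+1 * n)%N in
  let A := A3 (Dmx B Q) (Lmx M) Rk Hk in
  let A' := A3 (Dmx B Q) (Lmx M) (extend_R Rk r alpha) (extend_H Hk h) in
  [/\ size (neg_spectrum A) = m, size (pos_spectrum A) = (m + k)%N,
      size (neg_spectrum A') = m & size (pos_spectrum A') = (m + k.+1)%N] /\
  [/\ lambda A' (- m%:Z) <= lambda A (- m%:Z),
      lambda A' (- 1) <= lambda A (- 1),
      lambda A (m + k)%N%:Z <= lambda A' (m + k.+1)%N%:Z
    & lambda A' 1 <= lambda A 1].
Proof.
move=> m A A'.
have hD := symposdef_Dmx hB hQ; have uL := unitmx_Lmx M.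
have [J JJ AE] := A3_compress (Dmx B Q) (Lmx M) Rk Hk r alpha h.
have symA' : A'^T = A' by apply: tr_A3.
have lower i : (i < m + (k + m))%N -> (spectrum A')`_i <= (spectrum A)`_i.
  by move=> im; rewrite /A AE cauchy_interlacing_lower.
have upper i : (i < m + (k + m))%N -> (spectrum A)`_i <= (spectrum A')`_i.+1.
  move=> im; rewrite /A AE; have := cauchy_interlacing_upper symA' JJ im.
  have -> : (m + (k + 1 + m) - (m + (k + m)) = 1)%N by lia.
  by rewrite -[i.+1]addn1; apply; lia.
split.
  by split; rewrite ?size_neg_spectrum_A3 ?size_pos_spectrum_A3 // addn1.
have m_gt0 : (0 < m)%N by rewrite muln_gt0.
(* The position lemmas for [lambda] take the index as a successor, so m is put in that form. *)
have mE : m = m.-1.+1 by rewrite prednK.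
have mkE j : (m + j)%N = (m.-1 + j).+1 by rewrite {1}mE.
have i0 : (m.-1 < m)%N by rewrite -mE.
split.
- by rewrite [in - _]mE !lambda_neg_A3 // lower //; lia.
- by rewrite !(@lambda_neg_A3 _ _ _ _ _ _ _ _ _ _ 0) // lower //; lia.
(* The last entries of the two spectra are one position apart, hence [upper]; the other three goals
   compare equal positions. *)
- rewrite !mkE !lambda_pos_A3 // [(m.-1 + k.+1)%N]addnS.
  by rewrite [(_ + (m.-1 + k).+1)%N]addnS upper //; lia.
- by rewrite !(@lambda_pos_A3 _ _ _ _ _ _ _ _ _ _ 0) // lower //; lia.
Qed.
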